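(* Let $n\in\mathbb{Z}_+^d$ be a prebasis and let $A$ be a $d\times d'$ natural number matrix. Then the macrotile map $\mathrm{M}_{A,n}:X_n\to X_{n^A}$ is surjective.
   Context: $\mathbb{N}=\{0,1,2,\dots\}$, $\mathbb{Z}_+$ is the set of positive integers, $\Sigma_N=\{0,\dots,N-1\}$; natural number matrices have entries in $\mathbb{N}$. Vectors are ordered coordinatewise; $\mathbf{0},\mathbf{1}$ are constant vectors; $e_i$ are the standard basis vectors. A prebasis of dimension $d$ is any $n\in\mathbb{Z}_+^d$; put $N=\prod_i n[i]$ and $m(n,v)=\prod_{j=1}^d n[j]^{-v[j]}$ for $v\in\mathbb{Z}^d$. **Cubes.** For $a\in\mathbb{N}$ and $\mathbf{0}\ge v_1\ge v_2$ in $\mathbb{Z}^d$, $\mathrm{base}_n(a,(v_1,v_2))[2]$ denotes the integer $a_1$ in the unique representation $a=a_0+a_1m(n,v_1)+a_2m(n,v_2)$ with integers $0\le a_0<m(n,v_1)$, $0\le a_1<m(n,v_2)/m(n,v_1)$, $a_2\ge0$. For $a\in\Sigma_N$, $\mathrm{cube}_n(a)$ is the function on pairs $v_1\ge v_2$ in $\{-1,0\}^d$ given by $\mathrm{cube}_n(a)[v_1,v_2]=\mathrm{base}_n(a,(v_1,v_2))[2]$; $T_n=\{\mathrm{cube}_n(a):a\in\Sigma_N\}$. $X_n$ is the set of maps $f:\mathbb{Z}^d\to T_n$ such that $f[z][\mathbf{0},-\mathbf{1}+e_i]=f[z+e_i][-e_i,-\mathbf{1}]$ for all $z\in\mathbb{Z}^d$,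 $1\le i\le d$. **Labels.** For $f\in X_n$ the edge $\{z-e_i,z\}$ has label $\lambda(f,\{z-e_i,z\})=f[z][\mathbf{0},-e_i]$. If $p'-p=ae_j$ with $a=\pm1$, $(p,p')f=a\,m(n,\max\{p,p'\})\lambda(f,\{p,p'\})$. For general $p,p'\in\mathbb{Z}^d$, $(p,p')f=\sum_i(P_i,P_{i+1})f$ over any path of unit steps from $p$ to $p'$ (independent of the path), and $\lambda(f,(p,p'))=(p,p')f/m(n,p')$. **Macrotile map.** For a $d\times d'$ matrix $A$ over $\mathbb{N}$, $n^A\in\mathbb{Z}_+^{d'}$ is the prebasis $n^A[i]=m(n,-Ae_i)$, and $\mathrm{M}_{A,n}:X_n\to X_{n^A}$ is $\mathrm{M}_{A,n}(f)[v]=\mathrm{cube}_{n^A}(\lambda(f,(A(v-\mathbf{1}),Av)))$ for $v\in\mathbb{Z}^{d'}$ (this is indeed an element of $X_{n^A}$). *)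

(* Defs.v *)
From mathcomp Require Import all_boot all_order all_algebra.
From mathcomp Require Import boolp classical_sets functions.
From mathcomp Require Import zify ring lra.

Set Implicit Arguments.
Unset Strict Implicit.
Unset Printing Implicit Defensive.

Import Order.TTheory GRing.Theory Num.Theory.
Local Open Scope classical_set_scope.
Local Open Scope ring_scope.

(* Z^d is 'cV[int]_d; a map n : 'I_d -> nat is a prebasis of dimension d if   *)
(* its values are all positive.                                               *)
Definition prebasis d (n : 'I_d -> nat) : Prop := forall i, (0 < n i)%N.

Definition prebasis_size d (n : 'I_d -> nat) : nat := (\prod_i n i)%N.

Definition ev d (i : 'I_d) : 'cV[int]_d := delta_mx i 0.

Definition lev d (u v : 'cV[int]_d) : bool := [forall i, u i 0 <= v i 0].

Definition maxv d (u v : 'cV[int]_d) : 'cV[int]_d :=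
  \col_i Num.max (u i 0) (v i 0).

Definition m d (n : 'I_d -> nat) (v : 'cV[int]_d) : rat :=
  \prod_j (n j)%:R ^ (- v j 0).

(* The middle digit a_1 of a = a_0 + a_1 m(n,v1) + a_2 m(n,v2). For           *)
(* 0 >= v1 >= v2 the two rationals below are natural numbers, so truncation   *)
(* is just a cast (m_nat, m_div), and base_digitP is the defining property.   *)
Definition base_digit d (n : 'I_d -> nat) (a : nat) (v1 v2 : 'cV[int]_d) : nat :=
  ((a %/ Num.truncn (m n v1)) %% Num.truncn (m n v2 / m n v1))%N.

Definition unit_pair d (v : 'cV[int]_d * 'cV[int]_d) : bool :=
  [&& [forall i, v.1 i 0 \in [:: -1; 0]],
      [forall i, v.2 i 0 \in [:: -1; 0]] & lev v.2 v.1].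

(* The pairs v1 >= v2 in {-1,0}^d, the common domain of all cubes. *)
Definition vertex_pair d := {v : 'cV[int]_d * 'cV[int]_d | unit_pair v}.

Definition cube d (n : 'I_d -> nat) (a : nat) : vertex_pair d -> nat :=
  fun v => base_digit n a (val v).1 (val v).2.

Definition tiles d (n : 'I_d -> nat) : set (vertex_pair d -> nat) :=
  cube n @` [set a | (a < prebasis_size n)%N].

Lemma unit_pair_edge d (i : 'I_d) : unit_pair (0, - ev i).
Proof.
apply/and3P; split; apply/forallP => j; rewrite /ev !mxE ?inE ?eqxx ?andbT //=;
  by case: (j == i).
Qed.

Lemma unit_pair_top d (i : 'I_d) : unit_pair (0, const_mx (-1) + ev i).
Proof.
apply/and3P; split; apply/forallP => j; rewrite /ev !mxE ?inE ?eqxx ?andbT //=;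
  by case: (j == i).
Qed.

Lemma unit_pair_bot d (i : 'I_d) : unit_pair (- ev i, const_mx (-1)).
Proof.
apply/and3P; split; apply/forallP => j; rewrite /ev !mxE ?inE ?eqxx ?andbT //=;
  by case: (j == i).
Qed.

Definition edge_pair d (i : 'I_d) : vertex_pair d := exist (@unit_pair d) _ (unit_pair_edge i).
Definition top_pair d (i : 'I_d) : vertex_pair d := exist (@unit_pair d) _ (unit_pair_top i).
Definition bot_pair d (i : 'I_d) : vertex_pair d := exist (@unit_pair d) _ (unit_pair_bot i).

Definition tiling d := 'cV[int]_d -> vertex_pair d -> nat.

Definition X d (n : 'I_d -> nat) : set (tiling d) :=
  [set f | (forall z : 'cV[int]_d, tiles n (f z)) /\
           (forall (z : 'cV[int]_d) (i : 'I_d),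
              f z (top_pair i) = f (z + ev i) (bot_pair i))].

(* The label of the edge {z - e_i, z}. *)
Definition edge_label d (f : tiling d) (z : 'cV[int]_d) (i : 'I_d) : nat :=
  f z (edge_pair i).

(* A unit step is a pair (j, b) standing for e_j if b = false and for - e_j   *)
(* if b = true; a path is given by its origin and its sequence of steps.      *)
Definition step_end d (p : 'cV[int]_d) (s : 'I_d * bool) : 'cV[int]_d :=
  p + (-1) ^+ s.2 *: ev s.1.

Definition step_diff d (n : 'I_d -> nat) (f : tiling d)
    (p : 'cV[int]_d) (s : 'I_d * bool) : rat :=
  let q := maxv p (step_end p s) in
  (-1) ^+ s.2 * m n q * (edge_label f q s.1)%:R.

Definition path_end d (p : 'cV[int]_d) (s : seq ('I_d * bool)) : 'cV[int]_d :=
  foldl (@step_end d) p s.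

Fixpoint path_diff d (n : 'I_d -> nat) (f : tiling d)
    (p : 'cV[int]_d) (s : seq ('I_d * bool)) : rat :=
  if s is x :: s' then step_diff n f p x + path_diff n f (step_end p x) s'
  else 0.

Definition straight_path d (p p' : 'cV[int]_d) : seq ('I_d * bool) :=
  flatten [seq nseq `|((p' - p) j 0)%R|%N (j, (p' - p) j 0 < 0) | j <- enum 'I_d].

(* (p,p')f. The sum runs over one path from p to p' (path_end_straight); by   *)
(* path_diff_diff it takes the same value on all of them when f is in X n.    *)
Definition diff d (n : 'I_d -> nat) (f : tiling d) (p p' : 'cV[int]_d) : rat :=
  path_diff n f p (straight_path p p').

Definition label d (n : 'I_d -> nat) (f : tiling d) (p p' : 'cV[int]_d) : rat :=
  diff n f p p' / m n p'.

Definition zmx d d' (A : 'M[nat]_(d, d')) : 'M[int]_(d, d') := map_mx Posz A.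

(* Truncation is again a cast: see prebasis_powE and label_truncn. *)
Definition prebasis_pow d d' (n : 'I_d -> nat) (A : 'M[nat]_(d, d')) : 'I_d' -> nat :=
  fun i => Num.truncn (m n (- (zmx A *m ev i))).

Definition macrotile d d' (A : 'M[nat]_(d, d')) (n : 'I_d -> nat)
    (f : tiling d) : tiling d' :=
  fun v => cube (prebasis_pow n A)
    (Num.truncn (label n f (zmx A *m (v - const_mx 1)) (zmx A *m v))).

Lemma m0 d (n : 'I_d -> nat) : m n 0 = 1.
Proof. by rewrite /m big1 // => j _; rewrite mxE oppr0 expr0z. Qed.

Lemma mD d (n : 'I_d -> nat) (hn : prebasis n) u v : m n (u + v) = m n u * m n v.
Proof.
rewrite /m -big_split /=; apply: eq_bigr => j _.
by rewrite mxE opprD expfzDr // pnatr_eq0 -lt0n.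
Qed.

Lemma m_gt0 d (n : 'I_d -> nat) (hn : prebasis n) v : 0 < m n v.
Proof. by apply: prodr_gt0 => j _; rewrite exprz_gt0 // ltr0n. Qed.

Lemma m_neq0 d (n : 'I_d -> nat) (hn : prebasis n) v : m n v != 0.
Proof. by rewrite gt_eqF // m_gt0. Qed.

Lemma mN d (n : 'I_d -> nat) (hn : prebasis n) v : m n (- v) = (m n v)^-1.
Proof.
by apply: (mulfI (m_neq0 hn v)); rewrite -mD // subrr m0 divff // m_neq0.
Qed.

Lemma mB d (n : 'I_d -> nat) (hn : prebasis n) u v : m n (u - v) = m n u / m n v.
Proof. by rewrite mD // mN. Qed.

Lemma mNev d (n : 'I_d -> nat) i : m n (- ev i) = (n i)%:R.
Proof.
rewrite /m (bigD1 i) //= big1 => [|j /negPf ji]; rewrite /ev !mxE ?eqxx ?ji /=.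
  by rewrite opprK expr1z mulr1.
by rewrite !oppr0 expr0z.
Qed.

Lemma mN1 d (n : 'I_d -> nat) : m n (const_mx (-1)) = (prebasis_size n)%:R.
Proof.
rewrite /m /prebasis_size natr_prod; apply: eq_bigr => j _.
by rewrite mxE opprK expr1z.
Qed.

Lemma m_natP d (n : 'I_d -> nat) v : lev v 0 -> m n v \is a Num.nat.
Proof.
move=> /forallP v0; apply: rpred_prod => j _.
have := v0 j; rewrite mxE -oppr_ge0; case: (- v j 0) => // k _.
by rewrite -exprnP rpredX // natr_nat.
Qed.

Lemma m_nat d (n : 'I_d -> nat) v : lev v 0 -> (Num.truncn (m n v))%:R = m n v.
Proof. by move=> v0; rewrite truncnK // m_natP. Qed.

Lemma levB d (u v : 'cV[int]_d) : lev u v -> lev (u - v) 0.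
Proof.
move=> /forallP uv; apply/forallP => i.
by rewrite !mxE subr_le0.
Qed.

Lemma m_div d (n : 'I_d -> nat) (hn : prebasis n) v1 v2 : lev v2 v1 ->
  (Num.truncn (m n v2 / m n v1))%:R = m n v2 / m n v1.
Proof. by move=> v21; rewrite -mB // m_nat // levB. Qed.

(* Existence and uniqueness of the digit expansion. *)
Lemma base_digitP d (n : 'I_d -> nat) (hn : prebasis n) (a a1 : nat) v1 v2 :
  lev v1 0 -> lev v2 v1 ->
  base_digit n a v1 v2 = a1 <->
  exists a0 a2 : nat,
    [/\ a%:R = a0%:R + a1%:R * m n v1 + a2%:R * m n v2,
        a0%:R < m n v1 & a1%:R < m n v2 / m n v1].
Proof.
move=> v10 v21; rewrite /base_digit.
have := m_gt0 hn v1; have := m_neq0 hn v1.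
have : m n v2 = m n v1 * (m n v2 / m n v1) by rewrite mulrC divfK // m_neq0.
have : 0 < m n v2 / m n v1 by rewrite divr_gt0 // m_gt0.
rewrite -(m_div hn v21); move: (Num.truncn (m n v2 / _)) => q.
rewrite -(m_nat n v10); move: (Num.truncn (m n v1)) => k.
rewrite !ltr0n => q0 -> _ k0; rewrite !natrK; split.
- move=> <-; exists (a %% k)%N, (a %/ k %/ q)%N; split.
  + rewrite -!natrM -!natrD; congr (_%:R).
    have := divn_eq a k; have := divn_eq (a %/ k) q.
    move: (a %/ k)%N (a %% k)%N => b s; move: (b %/ q)%N (b %% q)%N => c r.
    by move=> -> ->; ring.
  + by rewrite ltr_nat ltn_mod.
  + by rewrite ltr_nat ltn_mod.
- case=> a0 [a2 []]; rewrite -!natrM -!natrD !ltr_nat => /eqP.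
  rewrite eqr_nat => /eqP -> a0k a1q.
  have -> : (a0 + a1 * k + a2 * (k * q) = (a2 * q + a1) * k + a0)%N by lia.
  by rewrite divnMDl // divn_small // addn0 modnMDl modn_small.
Qed.

Definition cosize d (n : 'I_d -> nat) (i : 'I_d) : nat :=
  (\prod_(j | j != i) n j)%N.

Lemma m_top d (n : 'I_d -> nat) i :
  m n (const_mx (-1) + ev i) = (cosize n i)%:R.
Proof.
rewrite /m (bigD1 i) //= /ev !mxE !eqxx /= addNr oppr0 expr0z mul1r.
rewrite /cosize natr_prod; apply: eq_bigr => j /negPf ji.
by rewrite !mxE ji /= addr0 opprK expr1z.
Qed.

Lemma m_bot d (n : 'I_d -> nat) (hn : prebasis n) i :
  m n (const_mx (-1)) / m n (- ev i) = (cosize n i)%:R.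
Proof. by rewrite -mB // opprK m_top. Qed.

Lemma cube_edge d (n : 'I_d -> nat) a i : cube n a (edge_pair i) = (a %% n i)%N.
Proof. by rewrite /cube /base_digit /= m0 mNev divr1 truncn1 divn1 natrK. Qed.

Lemma cube_top d (n : 'I_d -> nat) a i :
  cube n a (top_pair i) = (a %% cosize n i)%N.
Proof. by rewrite /cube /base_digit /= m0 m_top divr1 truncn1 divn1 natrK. Qed.

Lemma cube_bot d (n : 'I_d -> nat) (hn : prebasis n) a i :
  cube n a (bot_pair i) = ((a %/ n i) %% cosize n i)%N.
Proof. by rewrite /cube /base_digit /= m_bot // mNev !natrK. Qed.

Definition wt d (n : 'I_d -> nat) (f : tiling d) z i : rat :=
  m n z * (edge_label f z i)%:R.

Lemma step_diff_pos d (n : 'I_d -> nat) (f : tiling d) p i :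
  step_diff n f p (i, false) = wt n f (p + ev i) i.
Proof.
rewrite /step_diff /step_end /= expr0 scale1r mul1r /wt.
suff -> : maxv p (p + ev i) = p + ev i by [].
apply/colP => j; rewrite mxE max_r // !mxE lerDl; by case: eqP.
Qed.

Lemma step_diff_neg d (n : 'I_d -> nat) (f : tiling d) p i :
  step_diff n f p (i, true) = - wt n f p i.
Proof.
rewrite /step_diff /step_end /= expr1 scaleN1r mulN1r mulNr /wt.
suff -> : maxv p (p - ev i) = p by [].
apply/colP => j; rewrite mxE max_l // !mxE gerDl oppr_le0; by case: eqP.
Qed.

Lemma modn_pair a b c : (a %% b + b * ((a %/ b) %% c) = a %% (b * c))%N.
Proof.
rewrite modn_divl (mulnC c).
have := divn_eq (a %% (b * c)) b.
by rewrite modn_dvdm ?dvdn_mulr //; lia.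
Qed.

Lemma wt_square d (n : 'I_d -> nat) (hn : prebasis n) (f : tiling d) z i j :
  X n f -> i != j ->
  wt n f (z - ev i) j + wt n f z i = wt n f (z - ev j) i + wt n f z j.
Proof.
move=> [fT fR] ij; have [a aN fa] := fT z.
have H k l : k != l -> wt n f (z - ev k) l + wt n f z k =
    m n z * (edge_label f z k + n k * ((a %/ n k) %% n l))%N%:R.
  move=> kl; rewrite /wt mB // -mN // mNev natrD natrM mulrDr addrC -mulrA.
  congr (_ + _ * (_ * _%:R)).
  have [b bN fb] := fT (z - ev k).
  have := fR (z - ev k) k; rewrite subrK -fa -fb cube_top cube_bot //.
  rewrite /edge_label -fb cube_edge => E.
  have dv : (n l %| cosize n k)%N.
    by rewrite /cosize (bigD1 l) ?dvdn_mulr // eq_sym.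
  by rewrite -(modn_dvdm b dv) E modn_dvdm.
rewrite H // H 1?eq_sym //; congr (_ * _%:R).
rewrite /edge_label -fa !cube_edge !modn_pair.
by rewrite mulnC.
Qed.

Lemma path_diff_swap d (n : 'I_d -> nat) (hn : prebasis n) (f : tiling d) p x y :
  X n f ->
  step_diff n f p x + step_diff n f (step_end p x) y =
  step_diff n f p y + step_diff n f (step_end p y) x.
Proof.
move=> fX; case: x y => [i b] [j c].
rewrite /step_end /=; have [<-{j}|ij] := eqVneq i j.
  case: b c => [] [] //=; rewrite ?step_diff_pos ?step_diff_neg ?expr0 ?expr1
    ?scale1r ?scaleN1r ?subrK ?addrK; ring.
case: b c => [] [] //=; rewrite !(step_diff_pos, step_diff_neg) ?expr0 ?expr1
    ?scale1r ?scaleN1r.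
- by have := wt_square hn p fX ij; lra.
- have := wt_square hn (p + ev j) fX ij.
  by rewrite addrK addrAC; lra.
- have := wt_square hn (p + ev i) fX ij.
  by rewrite addrK addrAC; lra.
- have := wt_square hn (p + ev i + ev j) fX ij.
  by rewrite addrK (addrAC p) addrK; lra.
Qed.

Definition dir d (x : 'I_d * bool) : 'cV[int]_d := (-1) ^+ x.2 *: ev x.1.

Lemma path_endE d p (s : seq ('I_d * bool)) :
  path_end p s = p + \sum_(x <- s) dir x.
Proof.
elim: s p => [|x s IHs] p /=; first by rewrite big_nil addr0.
by rewrite IHs big_cons addrA.
Qed.

Lemma path_diff_cat d (n : 'I_d -> nat) (f : tiling d) p s t :
  path_diff n f p (s ++ t) = path_diff n f p s + path_diff n f (path_end p s) t.
Proof. by elim: s p => [|x s IHs] p /=; rewrite ?add0r // IHs addrA. Qed.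

Lemma step_endC d p (x y : 'I_d * bool) :
  step_end (step_end p x) y = step_end (step_end p y) x.
Proof. by rewrite /step_end addrAC. Qed.

Lemma path_diff_front d (n : 'I_d -> nat) (hn : prebasis n) (f : tiling d) p x s t :
  X n f -> path_diff n f p (s ++ x :: t) = path_diff n f p (x :: s ++ t).
Proof.
move=> fX; elim: s p => [//|y s IHs] p /=.
by rewrite IHs /= !addrA -path_diff_swap // step_endC.
Qed.

Lemma path_diff_perm d (n : 'I_d -> nat) (hn : prebasis n) (f : tiling d) p s t :
  X n f -> perm_eq s t -> path_diff n f p s = path_diff n f p t.
Proof.
move=> fX; elim: s p t => [|x s IHs] p t.
  by rewrite perm_sym => /perm_nilP ->.
move=> st; have xt : x \in t by rewrite -(perm_mem st) mem_head.
case/splitPr: xt st => t1 t2 st; rewrite path_diff_front //=; congr (_ + _).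
by apply: IHs; rewrite -(perm_cons x) (perm_trans st) // -cat1s perm_catCA.
Qed.

Lemma dir_coord d (s : seq ('I_d * bool)) j :
  (\sum_(x <- s) dir x) j 0 =
  (count_mem (j, false) s)%:Z - (count_mem (j, true) s)%:Z.
Proof.
elim: s => [|[i b] s IHs]; first by rewrite big_nil mxE.
rewrite big_cons mxE IHs /dir /ev /= !mxE !xpair_eqE eqxx andbT (eq_sym j).
by case: b; case: (i == j) => /=; lia.
Qed.

Lemma path_diff_closed d (n : 'I_d -> nat) (hn : prebasis n) (f : tiling d) p s :
  X n f -> \sum_(x <- s) dir x = 0 -> path_diff n f p s = 0.
Proof.
move=> fX; have [k] := ubnP (size s); elim: k s p => // k IHk [//|[j b] s] p /= sk s0.
have js : (j, ~~ b) \in s.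
  have /colP/(_ j) := s0; rewrite dir_coord mxE /= !xpair_eqE !eqxx /=.
  by rewrite -has_pred1 has_count; case: (b) => /=; lia.
have rs := perm_to_rem js; have := perm_size rs => /= srs.
rewrite (path_diff_perm hn _ fX rs) /= addrA.
move: s0; rewrite big_cons (perm_big _ rs) big_cons /=.
have -> u : dir (j, b) + (dir (j, ~~ b) + u) = u.
  by rewrite /dir addrA /= -scalerDl; case: (b) => /=; rewrite ?expr0 ?expr1 ?subrr ?addNr scale0r add0r.
move=> s0; rewrite IHk ?addr0 //; last by move: sk; rewrite srs; lia.
case: (b) => /=; rewrite /step_end step_diff_pos step_diff_neg /=;
  by rewrite ?expr0 ?expr1 ?scale1r ?scaleN1r ?subrK ?subrr ?addNr.
Qed.

Definition back d (s : seq ('I_d * bool)) := rev [seq (x.1, ~~ x.2) | x <- s].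

Lemma dirN d (x : 'I_d * bool) : dir (x.1, ~~ x.2) = - dir x.
Proof. by case: x => i [] ; rewrite /dir /= ?expr0 ?expr1 ?scaleN1r ?scale1r ?opprK. Qed.

Lemma sum_dir_back d (s : seq ('I_d * bool)) :
  \sum_(x <- back s) dir x = - \sum_(x <- s) dir x.
Proof.
rewrite /back (perm_big _ (permEl (perm_rev _))) /= big_map -sumrN.
by apply: eq_bigr => x _; rewrite dirN.
Qed.

Lemma path_diff_indep d (n : 'I_d -> nat) (hn : prebasis n) (f : tiling d) p s t :
  X n f -> path_end p s = path_end p t -> path_diff n f p s = path_diff n f p t.
Proof.
move=> fX; rewrite !path_endE => /addrI E.
have H u v : \sum_(x <- u) dir x = \sum_(x <- v) dir x ->
    path_diff n f p u + path_diff n f (path_end p u) (back v) = 0.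
  move=> uv; rewrite -path_diff_cat path_diff_closed //.
  by rewrite big_cat /= sum_dir_back uv subrr.
have := H _ _ E; have := H t t erefl.
by rewrite !path_endE E; lra.
Qed.

Lemma path_end_straight d (p p' : 'cV[int]_d) : path_end p (straight_path p p') = p'.
Proof.
rewrite path_endE; apply: (addrI (- p)); rewrite addKr addrC.
rewrite /straight_path big_flatten /= big_map big_enum /=.
apply/colP => j; rewrite summxE (bigD1 j) //= [X in _ + X]big1 => [|i /negPf ij];
  rewrite big_nseq iter_addr_0 /dir /ev /= mulmxnE !mxE ?ij ?eqxx /=.
  by rewrite addr0; move: (p' j 0 - p j 0) => k; case: ltrP => /= k0; lia.
by rewrite eq_sym ij mulr0 mul0rn.
Qed.

Lemma path_diff_diff d (n : 'I_d -> nat) (hn : prebasis n) (f : tiling d) p s :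
  X n f -> path_diff n f p s = diff n f p (path_end p s).
Proof. by move=> fX; apply: path_diff_indep; rewrite // path_end_straight. Qed.

Lemma diff_trans d (n : 'I_d -> nat) (hn : prebasis n) (f : tiling d) p q r :
  X n f -> diff n f p q + diff n f q r = diff n f p r.
Proof.
move=> fX; have := path_diff_cat n f p (straight_path p q) (straight_path q r).
rewrite path_end_straight => <-; rewrite path_diff_diff //; congr diff.
by rewrite path_endE big_cat /= addrA -!path_endE !path_end_straight.
Qed.

Lemma edge_label_lt d (n : 'I_d -> nat) (hn : prebasis n) (f : tiling d) z i :
  X n f -> (edge_label f z i < n i)%N.
Proof.
by case=> fT _; have [a _ fa] := fT z; rewrite /edge_label -fa cube_edge ltn_mod.
Qed.

Lemma path_end_rcons d p (s : seq ('I_d * bool)) x :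
  path_end p (rcons s x) = step_end (path_end p s) x.
Proof. exact: foldl_rcons. Qed.

Lemma label_bounded d (n : 'I_d -> nat) (hn : prebasis n) (f : tiling d) p q :
  X n f -> lev p q ->
  label n f p q \is a Num.nat /\ label n f p q < m n (p - q).
Proof.
move=> fX pq; rewrite -{1 2 3}(path_end_straight p q) /label.
have : all (fun x : 'I_d * bool => ~~ x.2) (straight_path p q).
  apply/allP => x /flatten_mapP[j _ /nseqP[-> _]] /=.
  by rewrite -leNgt !mxE subr_ge0 (forallP pq).
move: (straight_path p q) => s; rewrite -path_diff_diff //.
suff H : all (fun x => ~~ x.2) s -> [/\ path_diff n f p s / m n (path_end p s) \is a Num.nat,
    path_diff n f p s / m n (path_end p s) < m n (p - path_end p s) &
    m n (p - path_end p s) \is a Num.nat] by move=> /H[].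
elim/last_ind: s => [_|s [j b] IHs] /=.
  by rewrite mul0r subrr m0 ltr01 rpred0 rpred1.
rewrite all_rcons => /andP[/= /negPf -> /IHs {IHs}].
rewrite -cats1 path_diff_cat /= addr0 step_diff_pos cats1 path_end_rcons.
move: (path_end p s) => r; rewrite /step_end expr0 scale1r /=.
rewrite /wt mulrDl (mulrC (m n _)) mulfK ?m_neq0 //.
have -> : path_diff n f p s / m n (r + ev j) =
    path_diff n f p s / m n r * (n j)%:R.
  by rewrite mD // invfM -(mN hn (ev j)) mNev mulrA.
have -> : m n (p - (r + ev j)) = m n (p - r) * (n j)%:R.
  by rewrite opprD addrA (mD hn (p - r)) mNev.
have := edge_label_lt hn (r + ev j) j fX.
move: (edge_label _ _ _) => e en.
move: (_ / m n r) (m n (p - r)) => x M.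
case=> /natrP[k ->] kM /natrP[l lE]; move: kM; rewrite {}lE ltr_nat => kl.
rewrite -!natrM -natrD ltr_nat !natr_nat; split=> //.
have : (k.+1 * n j <= l * n j)%N by rewrite leq_mul2r kl orbT.
by rewrite mulSn; lia.
Qed.

Lemma label_truncn d (n : 'I_d -> nat) (hn : prebasis n) (f : tiling d) p q :
  X n f -> lev p q -> (Num.truncn (label n f p q))%:R = label n f p q.
Proof. by move=> fX pq; rewrite truncnK //; case: (label_bounded hn fX pq). Qed.

Lemma lev_zmx d d' (A : 'M[nat]_(d, d')) u v :
  lev u v -> lev (zmx A *m u) (zmx A *m v).
Proof.
move=> /forallP uv; apply/forallP => i; rewrite !mxE; apply: ler_sum => j _.
by rewrite ler_wpM2l // mxE.
Qed.

Lemma lev_ev d (i : 'I_d) : lev 0 (ev i).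
Proof. by apply/forallP => j; rewrite !mxE; case: eqP. Qed.

Lemma prebasis_powE d d' (n : 'I_d -> nat) (hn : prebasis n)
    (A : 'M[nat]_(d, d')) i :
  (prebasis_pow n A i)%:R = m n (- (zmx A *m ev i)).
Proof.
rewrite /prebasis_pow m_nat // -[- _]add0r levB // -(mulmx0 _ (zmx A)).
by rewrite lev_zmx // lev_ev.
Qed.

Lemma prebasis_prebasis_pow d d' (n : 'I_d -> nat) (A : 'M[nat]_(d, d')) :
  prebasis n -> prebasis (prebasis_pow n A).
Proof. by move=> hn i; rewrite -(ltr0n rat) prebasis_powE // m_gt0. Qed.

Lemma m_prebasis_pow d d' (n : 'I_d -> nat) (hn : prebasis n)
    (A : 'M[nat]_(d, d')) w :
  m (prebasis_pow n A) w = m n (zmx A *m w).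
Proof.
have -> : m n (zmx A *m w) = \prod_i m n (zmx A *m ev i) ^ w i 0.
  have -> : zmx A *m w = \sum_i w i 0 *: (zmx A *m ev i).
    rewrite {1}(matrix_sum_delta w) mulmx_sumr; apply: eq_bigr => i _.
    by rewrite big_ord1 scalemxAr.
  rewrite (big_morph _ (mD hn) (m0 n)); apply: eq_bigr => i _.
  rewrite /m (big_morph (fun x => x ^ w i 0) (fun x y => expfzMl x y _) (exp1rz _ _)).
  by apply: eq_bigr => j _; rewrite !mxE exprz_exp mulNr mulrC -mulNr.
rewrite {1}/m; apply: eq_bigr => i _.
by rewrite prebasis_powE // mN // exprz_inv opprK.
Qed.

Lemma macrotile_fun d d' (n : 'I_d -> nat) (hn : prebasis n)
    (A : 'M[nat]_(d, d')) :
  set_fun (X n) (X (prebasis_pow n A)) (macrotile A n).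
Proof.
have hA := prebasis_prebasis_pow A hn.
move=> f fX; split=> [z|z i].
  set q := zmx A *m z; set p := zmx A *m (z - const_mx 1).
  have pq : lev p q. by apply: lev_zmx; apply/forallP => j; rewrite !mxE; move: (z j 0) => k; lia.
  have [_] := label_bounded hn fX pq.
  exists (Num.truncn (label n f p q)) => //=.
  rewrite -(ltr_nat rat) label_truncn // -mN1 m_prebasis_pow //.
  suff -> : zmx A *m const_mx (-1) = p - q by [].
  rewrite /p /q -mulmxBr; congr (_ *m _).
  by apply/colP => j; rewrite !mxE; move: (z j 0) => k; lia.
rewrite /macrotile cube_top cube_bot //.
set p0 := zmx A *m (z - const_mx 1); set p1 := zmx A *m z.
set p2 := zmx A *m (z + ev i - const_mx 1); set p3 := zmx A *m (z + ev i).
have l01 : lev p0 p1 by apply: lev_zmx; apply/forallP => j; rewrite !mxE; move: (z j 0) => k; lia.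
have l02 : lev p0 p2 by apply: lev_zmx; apply/forallP => j; rewrite !mxE; move: (z j 0) => k; case: eqP => _ /=; lia.
have l21 : lev p2 p1 by apply: lev_zmx; apply/forallP => j; rewrite !mxE; move: (z j 0) => k; case: eqP => _ /=; lia.
have l23 : lev p2 p3 by apply: lev_zmx; apply/forallP => j; rewrite !mxE; move: (z j 0) => k; lia.
have l13 : lev p1 p3 by apply: lev_zmx; apply/forallP => j; rewrite !mxE; move: (z j 0) => k; case: eqP => _ /=; lia.
have E21 : m n (p2 - p1) = (cosize (prebasis_pow n A) i)%:R.
  rewrite -m_top m_prebasis_pow // /p2 /p1 -mulmxBr; congr (m n (_ *m _)).
  by apply/colP => j; rewrite !mxE; move: (z j 0) => k; lia.
have E13 : m n (p1 - p3) = (prebasis_pow n A i)%:R.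
  rewrite prebasis_powE // /p1 /p3 -mulmxBr -mulmxN; congr (m n (_ *m _)).
  by apply/colP => j; rewrite !mxE; move: (z j 0) => k; lia.
have add p q r : label n f p r = label n f q r + label n f p q * m n (q - r).
  rewrite /label -(diff_trans hn p q r fX) mB // [RHS]addrC mulrDl.
  by rewrite mulrA divfK // m_neq0.
have := add p0 p2 p1; have := add p2 p1 p3; rewrite E21 E13.
have := label_bounded hn fX l21; have := label_bounded hn fX l13; rewrite E21 E13.
rewrite -(label_truncn hn fX l01) -(label_truncn hn fX l02) -(label_truncn hn fX l21).
rewrite -(label_truncn hn fX l23) -(label_truncn hn fX l13) !ltr_nat !natrK.
move: (Num.truncn (label n f p0 p2)) (Num.truncn (label n f p0 p1)).
move: (Num.truncn (label n f p2 p1)) (Num.truncn (label n f p1 p3)).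
move: (Num.truncn (label n f p2 p3)) => e b c a g [_ cp] [_ bk].
rewrite -!natrM -!natrD => /eqP; rewrite eqr_nat => /eqP ->.
move=> /eqP; rewrite eqr_nat => /eqP ->.
rewrite addnC modnMDl addnC divnMDl ?hA // divn_small // addn0.
by rewrite !modn_small.
Qed.

(* Main.v *)
Require Import Defs.
From mathcomp Require Import all_boot all_order all_algebra.
From mathcomp Require Import boolp classical_sets functions.
From mathcomp Require Import zify ring.

(* A tiling f is determined by its potential F z = (0, z) f, and F comes from a
   tiling as soon as (F q - F p) / m(n, q) is a natural number < m(n, p - q) for
   all p <= q. Since m(n^A, v) = m(n, A v), it suffices to extend the potential G
   of a tiling in X(n^A) from the points A v to all of Z^d. Take nested cosets
   c(z) of m(n, z) Z with G v in c(A v): they amount to extending the adic limit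
   of G at - infinity to the primes of n that do not divide n^A, which is the
   Chinese remainder theorem. Let D be the down-closure of the values of G. Then
   F z is the largest element of c(z) in D; working with D rather than with the
   real number sup G settles the ambiguity when sup G lies in c(z). *)

Set Implicit Arguments.
Unset Strict Implicit.
Unset Printing Implicit Defensive.

Import Order.TTheory GRing.Theory Num.Theory.
Local Open Scope classical_set_scope.
Local Open Scope ring_scope.

(* The functions z |-> (0, z) f + constant, for f in X n: see potential_diff and
   diff_tiling_of. *)
Definition potential d (n : 'I_d -> nat) (F : 'cV[int]_d -> rat) : Prop :=
  forall p q, lev p q ->
    (F q - F p) / m n q \is a Num.nat /\ (F q - F p) / m n q < m n (p - q).

Definition plabel d (n : 'I_d -> nat) (F : 'cV[int]_d -> rat) p q : nat :=
  Num.truncn ((F q - F p) / m n q).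

Lemma lev_trans d (p q r : 'cV[int]_d) : lev p q -> lev q r -> lev p r.
Proof.
move=> /forallP pq /forallP qr; apply/forallP => i.
exact: le_trans (pq i) (qr i).
Qed.

Lemma diffE d (n : 'I_d -> nat) (hn : prebasis n) (f : tiling d) p q :
  X n f -> diff n f p q = diff n f 0 q - diff n f 0 p.
Proof. by move=> fX; rewrite -(diff_trans hn 0 p q fX) addrC addKr. Qed.

Lemma potential_diff d (n : 'I_d -> nat) (hn : prebasis n) (f : tiling d) :
  X n f -> potential n (diff n f 0).
Proof. by move=> fX p q pq; rewrite -diffE //; apply: label_bounded. Qed.

(** * From potentials back to tilings *)

Section Potential.
Variables (d : nat) (n : 'I_d -> nat) (F : 'cV[int]_d -> rat).
Hypotheses (hn : prebasis n) (hF : potential n F).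

Lemma potential_le p q : lev p q -> F p <= F q.
Proof.
by move=> /hF[/natr_ge0]; rewrite pmulr_lge0 ?subr_ge0 // invr_gt0 m_gt0.
Qed.

(** The bound does not involve [q]; this is what bounds the down-closure of the values. *)
Lemma potential_lt p q : lev p q -> F q < F p + m n p.
Proof.
by move=> /hF[_]; rewrite mB // ltr_pM2r ?invr_gt0 ?m_gt0 // ltrBlDl.
Qed.

Lemma plabelE p q : lev p q -> (plabel n F p q)%:R = (F q - F p) / m n q.
Proof. by move=> pq; rewrite truncnK //; case: (hF pq). Qed.

Lemma plabel_lt p q k :
  lev p q -> m n (p - q) = k%:R -> (plabel n F p q < k)%N.
Proof. by move=> pq mk; rewrite -(ltr_nat rat) plabelE // -mk; case: (hF pq). Qed.

(** Differences of [F] add up, and passing from the unit [m n q] to [m n r] multiplies by [k], so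
    labels concatenate like digits in base [k]. *)
Lemma plabelD p q r k : lev p q -> lev q r -> m n (q - r) = k%:R ->
  plabel n F p r = (plabel n F p q * k + plabel n F q r)%N.
Proof.
move=> pq qr mk; apply/eqP; rewrite -(eqr_nat rat) natrD natrM !plabelE //.
  rewrite -mk mB // mulrA divfK ?m_neq0 // -mulrDl; apply/eqP; congr (_ / _); ring.
exact: lev_trans qr.
Qed.

Lemma plabel_mod p q r k : lev p q -> lev q r -> m n (q - r) = k%:R ->
  (plabel n F p r %% k)%N = plabel n F q r.
Proof.
by move=> pq qr mk; rewrite (plabelD pq qr mk) modnMDl modn_small // plabel_lt.
Qed.

Lemma plabel_div p q r k : lev p q -> lev q r -> m n (q - r) = k%:R ->
  (plabel n F p r %/ k)%N = plabel n F p q.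
Proof.
move=> pq qr mk; have kl := plabel_lt qr mk.
by rewrite (plabelD pq qr mk) divnMDl ?divn_small ?addn0 // (leq_trans _ kl).
Qed.

Definition tiling_of : tiling d :=
  fun z => cube n (plabel n F (z - const_mx 1) z).

Lemma lev_subset (z : 'cV[int]_d) i :
  [/\ lev (z - const_mx 1) (z - ev i), lev (z - ev i) z,
      lev (z - const_mx 1) (z + ev i - const_mx 1) &
      lev (z + ev i - const_mx 1) z].
Proof.
by split; apply/forallP => j; rewrite !mxE; move: (z j 0) => k; case: eqP => _ /=; lia.
Qed.

Lemma edge_tiling_of z i :
  edge_label tiling_of z i = plabel n F (z - ev i) z.
Proof.
have [l1 l2 _ _] := lev_subset z i.
rewrite /edge_label /tiling_of cube_edge (plabel_mod l1 l2) //.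
by rewrite -mNev addrC addKr.
Qed.

(** Both sides of the matching condition are the label from [z + ev i - const_mx 1] to [z]: the low
    digits of one tile, the high digits of the other. *)
Lemma X_tiling_of : X n tiling_of.
Proof.
split=> [z|z i].
  exists (plabel n F (z - const_mx 1) z) => //=.
  apply: plabel_lt; first by apply/forallP => j; rewrite !mxE gerBl.
  rewrite -mN1 addrC addKr; congr m; by apply/colP => j; rewrite !mxE.
rewrite /tiling_of cube_top cube_bot //.
have [_ _ l1 l2] := lev_subset z i.
have l3 : lev z (z + ev i).
  by apply/forallP => j; rewrite !mxE; case: eqP => _ /=; lia.
have mc : m n (z + ev i - const_mx 1 - z) = (cosize n i)%:R.
  by rewrite -m_top; congr m; apply/colP => j; rewrite !mxE; ring.
rewrite (plabel_mod l1 l2 mc) (plabel_div l2 l3 (k := n i)).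
  by rewrite modn_small // plabel_lt.
by rewrite -mNev opprD addrA addrN add0r.
Qed.

Lemma path_diff_tiling_of p s :
  path_diff n tiling_of p s = F (path_end p s) - F p.
Proof.
have wtE z i : wt n tiling_of z i = F z - F (z - ev i).
  have [_ l _ _] := lev_subset z i.
  by rewrite /wt edge_tiling_of plabelE // mulrC divfK // m_neq0.
elim: s p => [|[i b] s IHs] p /=; first by rewrite subrr.
rewrite {}IHs; case: b; rewrite ?step_diff_neg ?step_diff_pos wtE /step_end /=.
  by rewrite expr1 scaleN1r; ring.
by rewrite expr0 scale1r addrK; ring.
Qed.

Lemma diff_tiling_of p q : diff n tiling_of p q = F q - F p.
Proof. by rewrite /diff path_diff_tiling_of path_end_straight. Qed.

End Potential.

(** * Tiles recovered from labels *)

(** Walking down from [z] along [s] strips the mixed-radix digits of [a] one by one. Matching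
    determines the next tile only modulo [cosize n i], so the quotient is kept modulo the sizes of
    the directions outside [s], which still contains the next digit. *)
Lemma tile_digits d (n : 'I_d -> nat) (hn : prebasis n) (f : tiling d) z a
    (s : seq 'I_d) :
  X n f -> f z = cube n a -> uniq s ->
  let w := \sum_(i <- s) ev i in
  (exists2 b, f (z - w) = cube n b &
     (b = a %/ \prod_(i <- s) n i %[mod \prod_(i | i \notin s) n i])%N) /\
  diff n f (z - w) z = m n z * (a %% \prod_(i <- s) n i)%N%:R.
Proof.
move=> fX fz; elim: s => [_|i s IHs] /=.
  rewrite !big_nil modn1 mulr0 subr0; split; last first.
    by rewrite diffE // subrr.
  by exists a; rewrite // divn1.
case/andP=> i_s us; have {IHs} := IHs us; rewrite !big_cons.
set w := \sum_(j <- s) _; set P := (\prod_(j <- s) n j)%N.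
have -> : z - (ev i + w) = z - w - ev i by rewrite opprD addrA addrAC.
have sR : (\prod_(j | j \notin s) n j = n i * \prod_(j | j \notin i :: s) n j)%N.
  rewrite (bigD1 i) //=; congr (_ * _)%N; apply: eq_bigl => j.
  by rewrite inE negb_or andbC.
rewrite {}sR; set R := (\prod_(j | _) _)%N.
case=> [[b fb bE] dE].
have mw : m n (z - w) = m n z * P%:R.
  rewrite mD //; congr (_ * _); rewrite /w -sumrN.
  rewrite (big_morph _ (mD hn) (m0 n)) /P natr_prod.
  by apply: eq_bigr => j _; rewrite mNev.
split.
  have [b' _ fb'] := fX.1 (z - w - ev i); exists b' => //.
  have := fX.2 (z - w - ev i) i; rewrite subrK -fb' fb cube_top cube_bot // => E.
  have dv : (R %| cosize n i)%N.
    have -> : R = (\prod_(j | (j != i) && (j \notin s)) n j)%N.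
      by apply: eq_bigl => j; rewrite inE negb_or.
    by rewrite /cosize [X in (_ %| X)%N](bigID (mem s)) dvdn_mull.
  rewrite -(modn_dvdm b' dv) E modn_dvdm // [in RHS]mulnC divnMA.
  by rewrite modn_divl [RHS]modn_divl (mulnC R) bE.
rewrite -(diff_trans hn _ (z - w)) // dE.
have := path_diff_diff hn (z - w - ev i) [:: (i, false)] fX.
rewrite /= addr0 step_diff_pos /step_end expr0 scale1r subrK => <-.
rewrite /wt mw /edge_label fb cube_edge -(modn_dvdm b (dvdn_mulr R (dvdnn (n i)))).
rewrite bE modn_dvdm ?dvdn_mulr // (mulnC (n i)) -modn_pair natrD natrM.
by ring.
Qed.

Lemma tile_eq_cube_label d (n : 'I_d -> nat) (hn : prebasis n) (f : tiling d) z :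
  X n f -> f z = cube n (Num.truncn (label n f (z - const_mx 1) z)).
Proof.
move=> fX; have [a aN fa] := fX.1 z.
have [_] := tile_digits hn fX (esym fa) (enum_uniq 'I_d).
have -> : \sum_(i <- enum 'I_d) ev i = const_mx 1 :> 'cV[int]_d.
  rewrite big_enum /=; apply/colP => j; rewrite summxE mxE (bigD1 j) //= big1.
    by rewrite !mxE !eqxx addr0.
  by move=> i /negPf ij; rewrite !mxE eq_sym ij.
rewrite /label => ->; rewrite mulrAC mulfV ?m_neq0 // mul1r natrK.
by rewrite big_enum /= modn_small.
Qed.

(** * Chinese remainders and adic convergence *)

(** Every prime involved divides [M], and its exponent in [N] is less than [N]. *)
Lemma part_pi_dvd_exp (N M : nat) :
  (0 < N)%N -> (0 < M)%N -> (N`_\pi(M) %| M ^ N)%N.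
Proof.
move=> N0 M0; apply/(dvdn_partP _ (part_gt0 _ _)) => p.
rewrite pi_of_part // inE => /andP[_ pM].
have pp : prime p by move: pM; rewrite mem_primes => /andP[].
rewrite p_part pfactor_dvdn ?expn_gt0 ?M0 // lognX.
apply: (@leq_trans N); last by rewrite leq_pmulr // logn_gt0.
apply: (@leq_trans (logn p N)); last exact: ltnW (ltn_logl _ _).
by rewrite dvdn_leq_log // dvdn_part.
Qed.

(* The h k define an element of the M-adic integers; g extends it by 0 at the
   primes dividing N but not M, so that it converges N-adically as well. *)
Lemma adic_lift (N M : nat) (h : nat -> nat) : (0 < N)%N -> (0 < M)%N ->
  (forall k, h k.+1 = h k %[mod M ^ k])%N ->
  exists g : nat -> nat, (forall k, g k = h k %[mod M ^ k])%N /\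
    forall t, exists K, forall k, (K <= k)%N -> (g k = g K %[mod N ^ t])%N.
Proof.
move=> N0 M0 hS; pose q := (N`_\pi(M)^')%N.
have co k : coprime (M ^ k) (q ^ k).
  rewrite coprimeXl // coprimeXr // -{1}(part_pnat_id (pnat_pi M0)).
  exact: coprime_partC.
exists (fun k => chinese (M ^ k) (q ^ k) (h k) 0).
split=> [k|t]; first by rewrite chinese_modl.
(* From this index on, [N ^ t] divides [M ^ k * q ^ k]: the part of [N] at the primes of [M] divides
   [M ^ N], and the rest is [q]. *)
exists (N * t)%N; elim=> [|k IHk]; first by rewrite leqn0 => /eqP ->.
rewrite leq_eqVlt => /predU1P[-> //|]; rewrite ltnS => tk.
rewrite -(IHk tk).
have dv : (N ^ t %| M ^ k * q ^ k)%N.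
  rewrite -(partnC \pi(M) N0) expnMn dvdn_mul //.
    apply: (dvdn_trans (dvdn_exp2r _ (part_pi_dvd_exp N0 M0))).
    by rewrite -expnM dvdn_exp2l.
  by rewrite dvdn_exp2l // (leq_trans _ tk) // leq_pmull.
rewrite -(modn_dvdm _ dv) -[in RHS](modn_dvdm _ dv); congr (_ %% _)%N.
apply/eqP; rewrite chinese_remainder //.
have cl := chinese_modl (co k.+1) (h k.+1) 0.
have cr := chinese_modr (co k.+1) (h k.+1) 0.
rewrite chinese_modl // chinese_modr //; apply/andP; split; apply/eqP.
  have d1 : (M ^ k %| M ^ k.+1)%N by rewrite dvdn_exp2l.
  by rewrite -(modn_dvdm _ d1) cl modn_dvdm // hS.
have d1 : (q ^ k %| q ^ k.+1)%N by rewrite dvdn_exp2l.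
by rewrite -(modn_dvdm _ d1) cr modn_dvdm.
Qed.

Lemma int_gtN1 (x : rat) : x \is a Num.int -> -1 < x -> 0 <= x.
Proof.
by case/intrP=> i ->; rewrite -[-1]/((-1)%:~R) ltr_int ler0z; lia.
Qed.

Lemma nat_crossing (P : nat -> Prop) k :
  P 0%N -> ~ P k -> exists j, P j /\ ~ P j.+1.
Proof.
elim: k => // k IHk P0 nP; have [Pk|nPk] := pselect (P k); last exact: IHk.
by exists k.
Qed.

Lemma m_const d (n : 'I_d -> nat) (k : nat) :
  m n (const_mx (- k%:Z)) = (prebasis_size n ^ k)%:R.
Proof.
rewrite natrX /prebasis_size natr_prod -prodrXl; apply: eq_bigr => j _.
by rewrite mxE opprK.
Qed.

Lemma prebasis_size_gt0 d (n : 'I_d -> nat) :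
  prebasis n -> (0 < prebasis_size n)%N.
Proof. by move=> hn; apply: prodn_gt0. Qed.

Lemma lev_const d (z : 'cV[int]_d) :
  exists k : nat, forall l : nat, (k <= l)%N ->
    lev (const_mx (- l%:Z)) z /\ lev z (const_mx l%:Z).
Proof.
exists (\sum_j `|(z j 0)%R|)%N => l kl.
have zl j : (`|(z j 0)%R| <= l)%N.
  by apply: leq_trans kl; rewrite (bigD1 j) //= leq_addr.
by split; apply/forallP => j; rewrite !mxE; have := zl j; move: (z j 0); lia.
Qed.

(** * The down-closure of the values of a potential *)

Section Below.
Variables (d : nat) (n : 'I_d -> nat) (G : 'cV[int]_d -> rat).
Hypotheses (hn : prebasis n) (hG : potential n G).

(* The integer points k.1 are cofinal in Z^d, so this is the down-closure of
   the values of G. *)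
Definition below (x : rat) : Prop := exists k : nat, x <= G (const_mx k%:Z).

Lemma below_le (x y : rat) : x <= y -> below y -> below x.
Proof. by move=> xy [k yk]; exists k; apply: le_trans yk. Qed.

Lemma below_bound (x : rat) : below x -> x <= G 0 + 1.
Proof.
case=> k /le_trans; apply; rewrite ltW // -(m0 n) (potential_lt hn hG) //.
by apply/forallP => j; rewrite !mxE.
Qed.

(** The progression has a term at most [G 0], found by rounding down, and eventually exceeds the
    bound [G 0 + 1]; in between it leaves [below]. *)
Lemma exists_last_below (x0 mz : rat) : 0 < mz ->
  exists t : int, below (x0 + t%:~R * mz) /\ ~ below (x0 + t%:~R * mz + mz).
Proof.
move=> mz0; pose t0 := Num.floor ((G 0 - x0) / mz).
pose Q (j : nat) := below (x0 + (t0 + j%:Z)%:~R * mz).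
have Q0 : Q 0%N.
  exists 0%N; rewrite addr0 -lerBrDl -ler_pdivlMr // (_ : const_mx _ = 0).
    exact: floor_le.
  by apply/colP => j; rewrite !mxE.
have [j nQj] : exists j, ~ Q j.
  pose y := (G 0 + 1 - x0) / mz - t0%:~R.
  exists (Num.bound y) => /below_bound.
  have : y < (Num.bound y)%:R.
    have [y0|y0] := leP 0 y; first exact: archi_boundP.
    by apply: lt_le_trans y0 _; rewrite ler0n.
  rewrite -lerBrDl -ler_pdivlMr // intrD ltrBlDl => /lt_le_trans/[apply].
  by rewrite ltxx.
have [i [Pi nPi]] := nat_crossing Q0 nQj.
exists (t0 + i%:Z); split=> //; rewrite -addrA -{2}(mul1r mz) -mulrDl => b.
by apply: nPi; rewrite /Q -addn1 PoszD addrA intrD.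
Qed.

End Below.

(** * Extension of a potential along [A] *)

Lemma potential_lift d d' (n : 'I_d -> nat) (A : 'M[nat]_(d, d'))
    (G : 'cV[int]_d' -> rat) :
  prebasis n -> potential (prebasis_pow n A) G ->
  exists2 F, potential n F & forall v, F (zmx A *m v) = G v.
Proof.
move=> hn; set nA := prebasis_pow n A => hG.
have hA : prebasis nA by exact: prebasis_prebasis_pow.
pose h (k : nat) := plabel nA G (const_mx (- k%:Z)) 0.
have c0 (k : nat) : lev (const_mx (- k%:Z)) (0 : 'cV[int]_d').
  by apply/forallP => j; rewrite !mxE; lia.
have hS k : (h k.+1 = h k %[mod prebasis_size nA ^ k])%N.
  have l : lev (const_mx (- k.+1%:Z)) (const_mx (- k%:Z) : 'cV[int]_d').
    by apply/forallP => j; rewrite !mxE; lia.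
  have := m_const nA k; rewrite -[const_mx _]subr0 => E.
  by rewrite /h (plabelD hA hG l (c0 k) E) modnMDl.
have hE k : (h k)%:R = G 0 - G (const_mx (- k%:Z)).
  by rewrite /h (plabelE hG (c0 k)) m0 divr1.
have [g [gh gN]] :=
  adic_lift (prebasis_size_gt0 hn) (prebasis_size_gt0 hA) hS.
(* coset z is the class modulo m n z of the adic limit of the G (- k.1). *)
pose coset z x := exists K : nat, forall k, (K <= k)%N ->
  (x - (G 0 - (g k)%:R)) / m n z \is a Num.int.
have int_div (p q : 'cV[int]_d) : lev p q -> m n p / m n q \is a Num.int.
  by move=> pq; rewrite -mB // intr_nat // m_natP // levB.
(* The cosets are nested, [m n p] being an integer multiple of [m n q]. *)
have coset_le p q x : lev p q -> coset p x -> coset q x.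
  move=> pq [K xK]; exists K => k Kk.
  rewrite -(divfK (m_neq0 hn p) (x - _)) -[_ / m n q]mulrA.
  by apply: rpredM; [exact: xK | exact: int_div].
have coset_sub z x y : coset z x -> coset z y -> (y - x) / m n z \is a Num.int.
  move=> [K xK] [L yL].
  have := rpredB (yL _ (leq_maxr K L)) (xK _ (leq_maxl K L)).
  by rewrite -mulrBl; move: (G 0 - _) => c; rewrite opprB subrKA.
have mod_int a b c (r : rat) : (a = b %[mod c])%N -> c%:R / r \is a Num.int ->
    (a%:R - b%:R) / r \is a Num.int.
  move=> ab cr; rewrite (divn_eq a c) (divn_eq b c) ab !natrD !natrM.
  rewrite opprD addrACA subrr addr0 -mulrBl -mulrA rpredM //.
  by rewrite rpredB // natr_int.
have coset_ex z : exists x, coset z x.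
  have [t tz] := lev_const z; have {tz}[tz _] := tz t (leqnn t).
  (* For [- t.1 <= z] the number [prebasis_size n ^ t] is a multiple of [m n z], so [g] is
     eventually constant modulo [m n z]. *)
  have [K gK] := gN t; exists (G 0 - (g K)%:R); exists K => k Kk.
  rewrite opprB addrC subrKA; apply: mod_int (gK k Kk) _.
  by rewrite -m_const int_div.
pose good z x := [/\ coset z x, below G x & ~ below G (x + m n z)].
have good_ex z : exists x, good z x.
  have [x0 [K xK]] := coset_ex z.
  have [t [bt nbt]] := exists_last_below hA hG x0 (m_gt0 hn z).
  exists (x0 + t%:~R * m n z); split=> //; exists K => k Kk.
  rewrite addrAC mulrDl mulfK ?m_neq0 // rpredD ?intr_int //.
  exact: xK.
have [F FP] := choice good_ex.
have crossing x y r : below G x -> ~ below G (y + r) -> x < y + r.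
  by move=> bx nby; rewrite ltNge; apply/negP => /below_le/(_ bx).
(* Maximality at [p] gives [F q < F p + m n p]; maximality at [q] makes the integer
   [(F q - F p) / m n q] exceed -1, hence nonnegative. *)
have pF : potential n F.
  move=> p q pq; have [cp bp np] := FP p; have [cq bq nq] := FP q.
  have ti := coset_sub _ _ _ (coset_le _ _ _ pq cp) cq.
  split; last by rewrite mB // ltr_pM2r ?invr_gt0 ?m_gt0 // ltrBlDl crossing.
  rewrite natrEint ti int_gtN1 //.
  by rewrite ltr_pdivlMr ?m_gt0 // mulN1r ltrBrDl ltrBlDr crossing.
exists F => // v.
(* For large [k], both [G v - G (- k.1)] and [g k - h k] are multiples of [m nA v], which is
   [m n (A v)]. *)
have cG : coset (zmx A *m v) (G v).
  have [K vK] := lev_const v; exists K => k Kk; have [l _] := vK k Kk.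
  rewrite -m_prebasis_pow //.
  have -> : G v - (G 0 - (g k)%:R) =
      (G v - G (const_mx (- k%:Z))) + ((g k)%:R - (h k)%:R).
    by rewrite hE; ring.
  rewrite mulrDl rpredD //; first by have [/intr_nat] := hG _ _ l.
  apply: mod_int (gh k) _.
  by rewrite -m_const !m_prebasis_pow // int_div // lev_zmx.
have bG : below G (G v).
  have [K vK] := lev_const v; have [_ l] := vK K (leqnn K).
  by exists K; apply: (potential_le hA hG).
have nG : ~ below G (G v + m n (zmx A *m v)).
  case=> k; have [K vK] := lev_const v; have [_ l] := vK (maxn k K) (leq_maxr _ _).
  have l' : lev (const_mx k%:Z) (const_mx (maxn k K)%:Z : 'cV[int]_d').
    by apply/forallP => j; rewrite !mxE; have := leq_maxl k K; lia.
  move=> /le_trans/(_ (potential_le hA hG l')); rewrite leNgt -m_prebasis_pow //.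
  by rewrite (potential_lt hA hG).
(* [G v] satisfies all the conditions defining [F (A v)]; two such elements of one coset differ by
   less than [m n (A v)], so they agree. *)
have [cF bF nF] := FP (zmx A *m v).
have mv := m_gt0 hn (zmx A *m v).
have : 0 <= (F (zmx A *m v) - G v) / m n (zmx A *m v).
  apply: int_gtN1 (coset_sub _ _ _ cG cF) _.
  by rewrite ltr_pdivlMr // mulN1r ltrBrDl ltrBlDr crossing.
have : 0 <= (G v - F (zmx A *m v)) / m n (zmx A *m v).
  apply: int_gtN1 (coset_sub _ _ _ cF cG) _.
  by rewrite ltr_pdivlMr // mulN1r ltrBrDl ltrBlDr crossing.
rewrite !pmulr_lge0 ?invr_gt0 // !subr_ge0 => l1 l2.
by apply/eqP; rewrite eq_le l1 l2.
Qed.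

Theorem theorem4p40 (d d' : nat) (n : 'I_d -> nat) (hn : prebasis n)
  (A : 'M[nat]_(d, d')) :
  set_surj (X n) (X (prebasis_pow n A)) (macrotile A n).
Proof.
move=> g gX; have hA := prebasis_prebasis_pow A hn.
have [F pF FG] := potential_lift hn (potential_diff hA gX).
exists (tiling_of n F); first exact: X_tiling_of.
apply: funext => v; rewrite (tile_eq_cube_label hA v gX) /macrotile.
congr (cube _ (Num.truncn _)).
(* Macrotile labels only see [F] at the points [A v], where it is the potential of [g]. *)
by rewrite /label diff_tiling_of // !FG -diffE // m_prebasis_pow.
Qed.
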